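(* Let $\mathcal{A}=(Q,\Sigma)$ be an $A_\omega$-automaton. Then in the $\omega$-game on $\mathcal{A}$ Alice has a strategy that allows her to win in fewer than $|Q|$ of her moves. In particular, the reset threshold of $\mathcal{A}$ is less than $|Q|$.
   Context: A DFA $\mathcal{A}=(Q,\Sigma)$ consists of finite nonempty sets $Q$ (states) and $\Sigma$ (letters) with a map $Q\times\Sigma\to Q$, $(q,a)\mapsto q\cdot a$, extended to words by $q\cdot\varepsilon=q$, $q\cdot(wa)=(q\cdot w)\cdot a$, and to subsets by $P\cdot w=\{p\cdot w:p\in P\}$. All DFAs considered have at least three states. A word $w\in\Sigma^*$ is a reset word for $\mathcal{A}$ if $|Q\cdot w|=1$; the reset threshold of a DFA having reset words (a synchronizing automaton) is the minimum length of its reset words. The $\omega$-game on $\mathcal{A}$: two players, Alice and Bob, alternate moves. On each of her turns Alice chooses a letter of $\Sigma$; on each of his turns Bob chooses an arbitrary finite word in $\Sigma^*$ (possibly empty). The history of the game up to a turn is the concatenation, in order, of all letters and words chosen so far. Alice wins if at some turn the history is a reset word for $\mathcal{A}$; Bob wins if the game continues forever. (It does not matter who moves first.) $\mathcal{A}$ is an $A_\omega$-automaton if Alice has a winning strategy in the $\omega$-game on $\mathcal{A}$. *)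

(* Defs.v *)
From mathcomp Require Import all_boot.

Set Implicit Arguments.
Unset Strict Implicit.
Unset Printing Implicit Defensive.

Definition dfa (Q Sigma : finType) := Q -> Sigma -> Q.

Section Automata.
Variables (Q Sigma : finType) (A : dfa Q Sigma).

Definition run (q : Q) (w : seq Sigma) : Q := foldl A q w.

Definition run_set (P : {set Q}) (w : seq Sigma) : {set Q} :=
  [set run p w | p in P].

Definition reset_word (w : seq Sigma) : bool := #|run_set [set: Q] w| == 1.

Definition synchronizing : Prop := exists w, reset_word w.

Definition reset_at (n : nat) : bool :=
  [exists w : n.-tuple Sigma, reset_word w].

Lemma synchronizing_reset_at : synchronizing -> exists n, reset_at n.
Proof. by case=> w rw; exists (size w); apply/existsP; exists (in_tuple w). Qed.

Definition reset_threshold (syncA : synchronizing) : nat :=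
  ex_minn (synchronizing_reset_at syncA).

End Automata.

Inductive player := Alice | Bob.

Section Game.
Variables (Q Sigma : finType) (A : dfa Q Sigma).

(* A strategy sees the list of all earlier moves; in such a list a letter a
   chosen by Alice is recorded as the one-letter word [:: a]. *)
Definition alice_strategy := seq (seq Sigma) -> Sigma.
Definition bob_strategy := seq (seq Sigma) -> seq Sigma.

Variable first : player.

(* Turns are numbered from 0. *)
Definition alice_turn (t : nat) : bool :=
  if first is Alice then ~~ odd t else odd t.

(* The list of the first t moves.  Play is continued formally after Alice has
   won, which has no effect on whether and when she first wins. *)
Fixpoint moves (s : alice_strategy) (b : bob_strategy) (t : nat) :
    seq (seq Sigma) :=
  if t is t'.+1 then
    let ms := moves s b t' in
    rcons ms (if alice_turn t' then [:: s ms] else b ms)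
  else [::].

Definition history (s : alice_strategy) (b : bob_strategy) (t : nat) :
    seq Sigma :=
  flatten (moves s b t).

Definition alice_moves (t : nat) : nat := count alice_turn (iota 0 t).

Definition winning (s : alice_strategy) : Prop :=
  forall b : bob_strategy, exists t : nat, reset_word A (history s b t).

Definition winning_in_fewer_than (k : nat) (s : alice_strategy) : Prop :=
  forall b : bob_strategy,
    exists t : nat, reset_word A (history s b t) /\ alice_moves t < k.

Definition A_omega : Prop := exists s : alice_strategy, winning s.

End Game.

(* Main.v *)
Require Import Defs.
From mathcomp Require Import all_boot.
From mathcomp Require Import zify.

(** If Alice wins, then for every non-total congruence [ker f] there are states
    [p], [q] in different classes such that, whatever word is applied, the
    images of [p] and [q] are congruent or some letter makes them congruent
    (otherwise Bob could always return to a pair which no letter makes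
    congruent).  These "mergeable" pairs form a stable graph containing [ker f];
    let [f'] be the map to its connected components, which is a coarser
    congruence.  A connected set meeting [c] classes of [ker f] stays connected
    under all words, so Alice can bring it into one [f]-class in [c - 1] moves,
    each time merging an edge.  By induction she brings [Q] into one class [K]
    of [f'] in [m' - 1] moves, and then into one class of [f] in [c - 1] moves;
    altogether this is at most [m - 1], where [m], [m'] are the numbers of
    classes of [f], [f'] and [c] that of classes of [f] in [K].  Start with
    [f = id]. *)

Set Implicit Arguments.
Unset Strict Implicit.
Unset Printing Implicit Defensive.

(** * Cardinalities of images of finite sets *)

Lemma card_imset_factor (T U V : finType) (f : T -> U) (g : T -> V)
    (P : {set T}) :
  (forall x y, f x = f y -> g x = g y) -> #|g @: P| <= #|f @: P|.
Proof.
move=> fg; pose h y := [pick x in P | f x == y].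
(* Passing to [option V] avoids a default element of [V], which may be empty. *)
rewrite -(card_imset _ (@Some_inj _)).
apply: leq_trans (leq_imset_card (fun y => omap g (h y)) (f @: P)).
apply/subset_leq_card/subsetP=> _ /imsetP[_ /imsetP[x Px ->] ->].
apply/imsetP; exists (f x); first exact: imset_f.
rewrite /h; case: pickP => [y /andP[_ /eqP/fg <-] //|/(_ x)].
by rewrite Px eqxx.
Qed.

(** Every value of [g] other than [g c] needs a value of [f] of its own, and these differ from the
    values of [f] on the fibre over [g c]. *)
Lemma card_imset_fiber (T U V : finType) (f : T -> U) (g : T -> V)
    (P : {set T}) c :
  (forall x y, f x = f y -> g x = g y) ->
  #|g @: P| + #|f @: [set x in P | g x == g c]| <= #|f @: P|.+1.
Proof.
move=> fg; set K := [set x in P | _]; set L := [set x in P | g x != g c].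
have leg : #|g @: P| <= #|g @: L|.+1.
  rewrite -add1n -(cards1 (g c)); apply: leq_trans (leq_card_setU _ _).
  apply/subset_leq_card/subsetP=> _ /imsetP[x Px ->]; rewrite !inE.
  have [//|ngx] := eqVneq (g x) (g c).
  by apply: imset_f; rewrite inE Px.
have /eqP disj : f @: K :&: f @: L == set0.
  apply/set0Pn=> -[y /setIP[/imsetP[x]]]; rewrite inE => /andP[_ /eqP gx] ->.
  by case/imsetP=> z; rewrite inE => /andP[_ /eqP gz] /fg; rewrite gx => /esym.
have leU : #|f @: K :|: f @: L| <= #|f @: P|.
  apply/subset_leq_card; rewrite subUset.
  by apply/andP; split; apply/imsetS/subsetP=> x; rewrite inE => /andP[].
have leL : #|g @: L| <= #|f @: L| by apply: card_imset_factor.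
by move: leU; rewrite cardsU disj cards0; lia.
Qed.

(** * Properties that hold at all reachable states *)

Section Box.
Variables (T Sigma : finType) (A : dfa T Sigma).

Lemma run_cat x u v : run A x (u ++ v) = run A (run A x u) v.
Proof. exact: foldl_cat. Qed.

Definition letter_step : rel T := fun x y => [exists a, y == A x a].

Lemma connect_runP x y :
  reflect (exists w, y = run A x w) (connect letter_step x y).
Proof.
apply: (iffP idP) => [/connectP[p]|[w ->]].
  elim: p x => [|z p IH] x /=; first by exists [::].
  by case/andP=> /existsP[a /eqP ->] /IH H /H[w ->]; exists (a :: w).
elim: w x => [|a w IH] x; first exact: connect0.
apply: connect_trans (IH (A x a)); apply: connect1.
by apply/existsP; exists a.
Qed.

(** Quantifying over the finitely many reachable states instead of over all words keeps this a
    boolean. *)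
Definition box (X : pred T) (x : T) : bool :=
  [forall y, connect letter_step x y ==> X y].

Lemma boxP (X : pred T) x : reflect (forall w, X (run A x w)) (box X x).
Proof.
apply: (iffP forallP) => [H w|H y].
  by apply: (implyP (H _)); apply/connect_runP; exists w.
by apply/implyP=> /connect_runP[w ->].
Qed.

Lemma boxPn (X : pred T) x : ~~ box X x -> exists w, ~~ X (run A x w).
Proof.
case/forallPn=> y; rewrite negb_imply => /andP[/connect_runP[w ->]].
by exists w.
Qed.

End Box.

(** * Words acting on sets and on pairs, and forcing in a given number of moves *)

Section Automaton.
Variables (Q Sigma : finType) (A : dfa Q Sigma).

Definition set_dfa : dfa {set Q} Sigma := fun P a => [set A p a | p in P].

Definition pair_dfa : dfa (Q * Q)%type Sigma := fun x a => (A x.1 a, A x.2 a).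

Lemma run_set_dfa (P : {set Q}) w : run set_dfa P w = run_set A P w.
Proof.
elim: w P => [|a w IH] P /=; first by rewrite /run_set imset_id.
by rewrite IH /run_set /set_dfa -imset_comp.
Qed.

Lemma run_pair_dfa x w : run pair_dfa x w = (run A x.1 w, run A x.2 w).
Proof. by elim: w x => [|a w IH] [p q] //=; rewrite IH. Qed.

Lemma run_set_cat (P : {set Q}) u v :
  run_set A P (u ++ v) = run_set A (run_set A P u) v.
Proof. by rewrite -!run_set_dfa run_cat. Qed.

Lemma run_setS (P P' : {set Q}) w :
  P \subset P' -> run_set A P w \subset run_set A P' w.
Proof. exact: imsetS. Qed.

(* [force G k P]: with Bob to move from [P], Alice can bring the image of [P]
   into [G] after exactly [k] moves of hers. *)
Fixpoint force (G : pred {set Q}) (k : nat) : pred {set Q} :=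
  if k is k'.+1 then box set_dfa (fun P => [exists a, force G k' (set_dfa P a)])
  else G.

Lemma forceSP G k (P : {set Q}) :
  reflect (forall w, exists a, force G k (run_set A P (rcons w a)))
          (force G k.+1 P).
Proof.
apply: (iffP (boxP _ _ _)) => H w.
  have [a Ha] := existsP (H w); exists a.
  by rewrite -cats1 -run_set_dfa run_cat.
have [a Ha] := H w; apply/existsP; exists a.
by move: Ha; rewrite -cats1 -run_set_dfa run_cat.
Qed.

Lemma forceS (G : pred {set Q}) k (P P' : {set Q}) :
  (forall X Y : {set Q}, X \subset Y -> G Y -> G X) ->
  P \subset P' -> force G k P' -> force G k P.
Proof.
move=> GS; elim: k P P' => [|k IH] P P' sPP'; first exact: GS.
move=> /forceSP H; apply/forceSP => w; have [a] := H w.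
by exists a; apply: IH (run_setS _ sPP') _.
Qed.

Lemma force_add (G G' : pred {set Q}) k l (P : {set Q}) :
  force G k P -> (forall X, G X -> force G' l X) -> force G' (k + l) P.
Proof.
move=> + GG'; elim: k P => [|k IH] P; first exact: GG'.
move=> /forceSP H; apply/forceSP => w; have [a Ha] := H w.
by exists a; apply: IH.
Qed.

(** For positive [k], Bob could have begun his next word with [w]; for [k = 0] the stability of [G]
    applies. *)
Lemma force_run (G : pred {set Q}) k (P : {set Q}) w :
  (forall X v, G X -> G (run_set A X v)) ->
  force G k P -> force G k (run_set A P w).
Proof.
move=> GA; case: k => [|k]; first exact: GA.
move=> /forceSP H; apply/forceSP => v; have [a Ha] := H (w ++ v).
by exists a; rewrite -run_set_cat -rcons_cat.
Qed.

(** Surplus moves are spent on an arbitrary letter, since no word leads out of [G]. *)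
Lemma force_leq (G : pred {set Q}) k l (P : {set Q}) :
  0 < #|Sigma| -> (forall X v, G X -> G (run_set A X v)) ->
  k <= l -> force G k P -> force G l P.
Proof.
move=> /card_gt0P[a0 _] GA /subnKC <- H; apply: force_add H _ => X.
elim: (l - k) X => [|m IH] X GX //; apply/forceSP => w.
by exists a0; apply/IH/GA.
Qed.

(** * Congruences, mergeable pairs and their connected components *)

Section Congruence.
Variable f : Q -> Q.

(** A congruence is represented by a map with that kernel, so classes are counted as values of
    [f]. *)
Definition ker_stable : Prop :=
  forall p q a, f p = f q -> f (A p a) = f (A q a).

(** Admitting the empty set makes this pass to all subsets. *)
Definition in_class : pred {set Q} := fun P => #|f @: P| <= 1.

Definition mergeable : rel Q := fun p q =>
  box pair_dfa
    (fun x => (f x.1 == f x.2) || [exists a, f (A x.1 a) == f (A x.2 a)])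
    (p, q).

Lemma mergeableP p q :
  reflect (forall w, f (run A p w) = f (run A q w) \/
             exists a, f (A (run A p w) a) = f (A (run A q w) a))
          (mergeable p q).
Proof.
apply: (iffP (boxP _ _ _)) => H w; have := H w; rewrite run_pair_dfa /=.
  by case/orP=> [/eqP|/existsP[a /eqP Ha]]; [left | right; exists a].
by case=> [->|[a Ha]]; rewrite ?eqxx //; apply/orP; right; apply/existsP;
  exists a; apply/eqP.
Qed.

Lemma mergeable_run p q w :
  mergeable p q -> mergeable (run A p w) (run A q w).
Proof.
move=> /mergeableP H; apply/mergeableP => v.
by rewrite -!run_cat; apply: H.
Qed.

Lemma mergeable_sym : symmetric mergeable.
Proof.
by apply: symmetric_from_pre => p q /mergeableP H; apply/mergeableP => w;
  case: (H w) => [->|[a Ha]]; [left | right; exists a].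
Qed.

Lemma in_classS (X Y : {set Q}) : X \subset Y -> in_class Y -> in_class X.
Proof. by move=> sXY; apply/leq_trans/subset_leq_card/imsetS. Qed.

Hypothesis f_stable : ker_stable.

Lemma ker_stable_run p q w : f p = f q -> f (run A p w) = f (run A q w).
Proof. by elim: w p q => //= a w IH p q /(f_stable a)/IH. Qed.

Lemma ker_mergeable p q : f p = f q -> mergeable p q.
Proof. by move=> fpq; apply/mergeableP => w; left; apply: ker_stable_run. Qed.

Lemma card_imset_run (P : {set Q}) w : #|f @: run_set A P w| <= #|f @: P|.
Proof.
by rewrite -imset_comp; apply: card_imset_factor => p q /(ker_stable_run w).
Qed.

Lemma in_class_run (P : {set Q}) w : in_class P -> in_class (run_set A P w).
Proof. exact/leq_trans/card_imset_run. Qed.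

(* Connectedness of the subgraph induced on [K], stated through cuts so that it
   visibly passes to homomorphic images. *)
Definition merge_connected (K : {set Q}) : Prop :=
  forall X : pred Q,
    {in K &, forall p q, mergeable p q -> X p -> X q} ->
    {in K &, forall p q, X p -> X q}.

(** A cut of the image pulls back along [w] to a cut of [K]. *)
Lemma merge_connected_run (K : {set Q}) w :
  merge_connected K -> merge_connected (run_set A K w).
Proof.
move=> Kc X cutX _ _ /imsetP[p Kp ->] /imsetP[q Kq ->].
apply: (Kc [pred x | X (run A x w)]) => //= x y Kx Ky /(mergeable_run w).
by apply: cutX; apply: imset_f.
Qed.

(** Otherwise no edge inside [K] would leave the [f]-class of a point, and that class would cut
    [K]. *)
Lemma merge_connected_split (K : {set Q}) :
  merge_connected K -> 1 < #|f @: K| ->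
  exists2 x, (x.1 \in K) && (x.2 \in K) & mergeable x.1 x.2 /\ f x.1 <> f x.2.
Proof.
move=> Kc K2.
have [/existsP[x /and4P[K1 K2' m n]]|] :=
  boolP [exists x, [&& x.1 \in K, x.2 \in K, mergeable x.1 x.2
                    & f x.1 != f x.2]].
  by exists x; [exact/andP | split=> //; apply/eqP].
move/existsPn=> H; case/card_gt1P: K2 
  => _ [_ [/imsetP[p Kp ->] /imsetP[q Kq ->] /eqP[]]].
apply/eqP; rewrite eq_sym.
apply: (Kc [pred x | f x == f p] _ p q) => //= x y Kx Ky m /eqP <-.
by have := H (x, y); rewrite /= Kx Ky m eq_sym negbK.
Qed.

Lemma force_connected (K : {set Q}) :
  0 < #|Sigma| -> merge_connected K -> force in_class #|f @: K|.-1 K.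
Proof.
move=> S0; have [m] := ubnP #|f @: K|; elim: m K => // m IH K ltm Kc.
case E: #|f @: K|.-1 => [|k]; first by rewrite /= /in_class; lia.
apply/forceSP => w; set L := run_set A K w.
have Lc : merge_connected L by apply: merge_connected_run.
have leLK : #|f @: L| <= #|f @: K| := card_imset_run K w.
(* It suffices that after Alice's letter at least one class fewer is met than by [K]. *)
have step a : #|f @: run_set A L [:: a]| <= k.+1 ->
    force in_class k (run_set A K (rcons w a)).
  move=> le; rewrite -cats1 run_set_cat -/L.
  apply: (force_leq S0 _ _ (IH _ _ (merge_connected_run Lc)));
    [by move=> X v; apply: in_class_run | lia | lia].
have [L1|L2] := leqP #|f @: L| 1.
  have /card_gt0P[a _] := S0; exists a; apply: step.
  by have := card_imset_run L [:: a]; lia.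
have [[p q] /andP[/= Lp Lq] [/mergeableP/(_ [::])[//|[a fpqa]] /= npq]] :=
  merge_connected_split Lc L2.
exists a; apply: step.
pose g x := f (A x a).
have -> : f @: run_set A L [:: a] = g @: L by rewrite -imset_comp.
have leg : #|g @: L| + #|f @: [set x in L | g x == g p]| <= #|f @: L|.+1.
  by apply: card_imset_fiber => x y /(@f_stable _ _ a).
(* Both [f p] and [f q] occur over [g p], so the letter [a] loses at least one class. *)
have : 1 < #|f @: [set x in L | g x == g p]|.
  apply/card_gt1P; exists (f p), (f q); split; last exact/eqP.
    by apply: imset_f; rewrite inE Lp eqxx.
  by apply: imset_f; rewrite inE Lq /g fpqa eqxx.
lia.
Qed.

(** Canonical representatives make this again a map from [Q] to [Q], so that the construction can be
    iterated. *)
Definition component : Q -> Q := root mergeable.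

Lemma mergeable_connect_sym : connect_sym mergeable.
Proof. by apply: sym_connect_sym; apply: mergeable_sym. Qed.

Lemma componentP p q :
  reflect (component p = component q) (connect mergeable p q).
Proof. by rewrite -(root_connect mergeable_connect_sym); apply: eqP. Qed.

(** The letter [a] carries a path of mergeable edges to such a path. *)
Lemma component_stable p q a :
  component p = component q -> component (A p a) = component (A q a).
Proof.
move=> /componentP/connectP[s + ->] {q}; elim: s p => //= q s IH p.
case/andP=> m /IH <-; apply/componentP/connect1.
exact: (mergeable_run [:: a] m).
Qed.

Lemma component_ker p q : f p = f q -> component p = component q.
Proof. by move=> fpq; apply/componentP/connect1/ker_mergeable. Qed.

(** A path between two points of a component stays inside it. The set is written as the fibre in
    [card_imset_fiber]. *)
Lemma component_connected c :
  merge_connected [set x in [set: Q] | component x == component c].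
Proof.
move=> X cutX p q; rewrite !inE /= => /eqP pc /eqP qc Xp.
have : connect mergeable p q by apply/componentP; rewrite pc.
case/connectP=> s; elim: s p pc Xp => [|y s IH] p pc Xp /=.
  by move=> _ ->.
case/andP=> m; have yc : component y = component c.
  by rewrite -pc; apply/esym/componentP/connect1.
by apply: IH => //; apply: cutX Xp; rewrite ?inE ?pc ?yc ?eqxx.
Qed.

End Congruence.

(** * Plays of the game: Bob's evasion and Alice's strategy *)

Section Game.
Variable first : player.

Lemma historyS (s : alice_strategy Sigma) (b : bob_strategy Sigma) t :
  history first s b t.+1 = history first s b t ++
    (if alice_turn first t then [:: s (moves first s b t)]
     else b (moves first s b t)).
Proof. by rewrite /history /= flatten_rcons. Qed.

Lemma alice_turnS t : alice_turn first t.+1 = ~~ alice_turn first t.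
Proof. by rewrite /alice_turn; case: first. Qed.

Lemma alice_movesS t :
  alice_moves first t.+1 = alice_moves first t + alice_turn first t.
Proof. by rewrite /alice_moves -addn1 iotaD count_cat /= addn0. Qed.

Lemma alice_moves_double k : alice_moves first k.*2 = k.
Proof.
elim: k => // k IH; rewrite doubleS !alice_movesS IH alice_turnS.
by case: alice_turn => /=; lia.
Qed.

Lemma size_moves (s : alice_strategy Sigma) (b : bob_strategy Sigma) t :
  size (moves first s b t) = t.
Proof. by elim: t => //= t IH; rewrite size_rcons IH. Qed.

Lemma A_omega_mergeable (f : Q -> Q) p0 q0 :
  A_omega A first -> f p0 <> f q0 ->
  exists p q, mergeable f p q /\ f p <> f q.
Proof.
move=> [s win] npq0.
have [/existsP[p /existsP[q /andP[m /eqP n]]]|none] :=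
  boolP [exists p, exists q, mergeable f p q && (f p != f q)].
  by exists p, q.
(* Bob's invariant: before his turns some pair is [apart]; before Alice's turns the history is
   [safe], so that no letter of hers makes that pair congruent. *)
pose apart h x := f (run A x.1 h) != f (run A x.2 h).
pose safe h := [exists x : Q * Q, apart h x && [forall a, apart (rcons h a) x]].
have bobP h : exists w, [exists x, apart h x] ==> safe (h ++ w).
  have [/existsP[[p q] npq]|] := boolP [exists x, apart h x]; last first.
    by exists [::].
  move: none => /existsPn/(_ (run A p h))/existsPn/(_ (run A q h)).
  rewrite [_ != _]npq andbT => /boxPn[w].
  rewrite run_pair_dfa /= -!run_cat negb_or.
  case/andP=> n /existsPn na; exists w; apply/existsP; exists (p, q).
  rewrite /apart n; apply/forallP=> a.
  by rewrite -cats1 !(run_cat _ _ _ [:: a]); apply: na.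
have safe_apart h : safe h -> [exists x, apart h x].
  by case/existsP=> x /andP[n _]; apply/existsP; exists x.
(* Alice may move first, so the empty history must be safe: Bob's word is absorbed into the choice
   of the starting pair. *)
have safe0 : safe [::].
  have /implyP := xchooseP (bobP [::]); set w := xchoose _ => H.
  have [|[p q]] := existsP (H _).
    by apply/existsP; exists (p0, q0); apply/eqP.
  case/andP=> n /forallP na; apply/existsP; exists (run A p w, run A q w).
  apply/andP; split; first exact: n.
  by apply/forallP=> a; have := na a; rewrite /apart -cats1 !run_cat.
pose b ms := xchoose (bobP (flatten ms)).
have apart_history t : if alice_turn first t then safe (history first s b t)
    else [exists x, apart (history first s b t) x].
  elim: t => [|t IH] /=; first by case: ifP => _ //; apply: safe_apart.
  rewrite historyS alice_turnS; case: ifP IH => _ H /=.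
    case/existsP: H => x /andP[_ /forallP/(_ (s (moves first s b t)))].
    by rewrite cats1 => n; apply/existsP; exists x.
  exact: (implyP (xchooseP (bobP _))).
have [t /cards1P[r Er]] := win b.
have /existsP[[p q] /eqP[]] : [exists x, apart (history first s b t) x].
  by have := apart_history t; case: ifP => // _ /safe_apart.
have inr x : run A x (history first s b t) = r.
  by apply/set1P; rewrite -Er; apply: imset_f.
by rewrite /= !inr.
Qed.

Lemma force_win k :
  0 < #|Q| -> 0 < #|Sigma| -> force (in_class id) k [set: Q] ->
  exists s : alice_strategy Sigma, winning_in_fewer_than A first k.+1 s.
Proof.
move=> Q0 /card_gt0P[a0 _] Fk.
pose P ms := run_set A [set: Q] (flatten ms).
(* The length of the record tells how many moves Alice has left. In plays that follow [s], the
   default [a0] is not reached during her first [k] moves. *)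
pose s ms := odflt a0 [pick a | force (in_class id)
  (k - (alice_moves first (size ms)).+1) (run_set A (P ms) [:: a])].
exists s => b; exists k.*2; rewrite alice_moves_double; split=> //.
have inv t : alice_moves first t <= k ->
    force (in_class id) (k - alice_moves first t) (P (moves first s b t)).
  elim: t => [_|t IH].
    have -> : P (moves first s b 0) = [set: Q] by exact: imset_id.
    by rewrite subn0.
  rewrite alice_movesS => le.
  have := IH; rewrite {1}/P -/(history first s b t) => {}IH.
  rewrite /P -/(history first s b t.+1) historyS run_set_cat.
  case: ifP le => _; rewrite ?addn0 ?addn1 => le.
    (* [force] gives Bob the first move; on Alice's turn he is taken to pass. *)
    have := IH (ltnW le); rewrite -subSS subSn //= => /forceSP/(_ [::])[a Fa].
    rewrite {2}/s size_moves; case: pickP => [//|/(_ a)].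
    by rewrite Fa.
  by apply: (force_run _ _ (IH le)) => X v; apply: in_class_run => p q a ->.
have := inv k.*2; rewrite alice_moves_double subnn leqnn => /(_ isT).
rewrite /= /in_class imset_id /reset_word /P => le1.
rewrite eqn_leq le1; apply/card_gt0P; have /card_gt0P[q _] := Q0.
by exists (run A q (history first s b k.*2)); apply: imset_f.
Qed.

End Game.

(** * Induction on the number of classes, and the theorem *)

Lemma force_class first (f : Q -> Q) :
  0 < #|Sigma| -> A_omega A first -> ker_stable f ->
  force (in_class f) #|f @: [set: Q]|.-1 [set: Q].
Proof.
move=> S0 hA; have [m] := ubnP #|f @: [set: Q]|; elim: m f => // m IH f ltm fA.
have [f1|/card_gt1P[_ [_ [/imsetP[p0 _ ->] /imsetP[q0 _ ->] /eqP n0]]]] :=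
  leqP #|f @: [set: Q]| 1.
  by have -> : #|f @: [set: Q]|.-1 = 0 by lia.
have [p [q [mpq npq]]] := A_omega_mergeable hA n0.
pose g := component f; have gA : ker_stable g by apply: component_stable.
pose K c := [set x in [set: Q] | g x == g c].
have leK c : #|g @: [set: Q]| + #|f @: K c| <= #|f @: [set: Q]|.+1.
  by apply: card_imset_fiber => x y; apply: component_ker.
(* The edge from [p] to [q] puts two classes of [f] into one component, so [g] has fewer classes
   than [f] and the induction hypothesis applies. *)
have K2 : 1 < #|f @: K p|.
  apply/card_gt1P; exists (f p), (f q); split; last exact/eqP.
    by apply: imset_f; rewrite !inE eqxx.
  apply: imset_f; rewrite !inE eq_sym; apply/eqP.
  by apply/componentP/connect1.
have := leK p => leKp.
have g0 : 0 < #|g @: [set: Q]|.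
  by apply/card_gt0P; exists (g p); apply: imset_f.
have Fg : force (in_class g) #|g @: [set: Q]|.-1 [set: Q].
  by apply: IH => //; lia.
(* The component reached in the first stage depends on Bob, so the bound for the second stage is
   uniform in it. *)
have Ff (X : {set Q}) : in_class g X ->
    force (in_class f) (#|f @: [set: Q]| - #|g @: [set: Q]|) X.
  move=> gX; have [X0|[c Xc]] := set_0Vmem X.
    apply: (force_leq S0 _ (leq0n _)); first by move=> Y v; apply: in_class_run.
    by rewrite X0 /= /in_class imset0 cards0.
  have sXK : X \subset K c.
    apply/subsetP=> x Xx; rewrite !inE; apply/eqP.
    by apply: (card_le1_eqP gX); apply: imset_f.
  have fK : 0 < #|f @: K c|.
    by apply/card_gt0P; exists (f c); apply: imset_f; rewrite !inE eqxx.
  have leKc : #|f @: K c|.-1 <= #|f @: [set: Q]| - #|g @: [set: Q]|.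
    by have := leK c; lia.
  apply: forceS (@in_classS f) sXK _.
  have Kc : merge_connected f (K c) by apply: component_connected.
  apply: (force_leq S0 _ leKc (force_connected fA S0 Kc)).
  by move=> Y v; apply: in_class_run.
have := force_add Fg Ff; congr (force _ _ _); lia.
Qed.

End Automaton.

Theorem theorem3p6 (Q Sigma : finType) (A : dfa Q Sigma) (first : player)
  (hQ : 2 < #|Q|) (hSigma : 0 < #|Sigma|) (hA : A_omega A first) :
  (exists s : alice_strategy Sigma, winning_in_fewer_than A first #|Q| s) /\
  (exists syncA : synchronizing A, reset_threshold syncA < #|Q|).
Proof.
have Q0 : 0 < #|Q| by lia.
have FQ : force A (in_class id) #|Q|.-1 [set: Q].
  have -> : #|Q| = #|id @: [set: Q]| by rewrite imset_id cardsT.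
  by apply: force_class hA _ => // p q a ->.
have [s win] := force_win first Q0 hSigma FQ; rewrite prednK // in win.
split; first by exists s.
(* If Bob always passes, the history consists of Alice's letters alone, and its length is the number
   of her moves. *)
have [t [rw lt]] := win (fun=> [::]).
set w := history first s _ t in rw; have syncA : synchronizing A by exists w.
exists syncA; apply: leq_ltn_trans lt; rewrite /reset_threshold.
have size_w : size w = alice_moves first t.
  rewrite /w; elim: t {w rw} => // t IH.
  by rewrite historyS size_cat IH alice_movesS; case: ifP.
rewrite -size_w; case: ex_minnP => n _; apply.
by apply/existsP; exists (in_tuple w).
Qed.
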